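(* Let $\phi(\mathbf x,\theta)=\arccos\big((\operatorname{trace}(\theta^\top\mathbf x)-1)/2\big)$ for $\mathbf x,\theta\in\mathrm{SO}(3)$, and let $h\colon L^\infty(\mathrm{SO}(3))\to\mathbb R$ be bounded (maps bounded sets to bounded sets) with $h(g\circ\psi)=h(g)$ for all $g\in L^\infty(\mathrm{SO}(3))$ and every bijection $\psi\colon\mathrm{SO}(3)\to\mathrm{SO}(3)$. Let $\mu_0,\nu_0\in\mathcal P^+_{\phi,c}(\mathrm{SO}(3))$ satisfy $\mathcal N_{h,\phi}[\mu_0]\neq\mathcal N_{h,\phi}[\nu_0]$ and consider $$\mathbb F=\{(\mathbf R\cdot)_\#\mu_0:\mathbf R\in\mathrm{SO}(3)\},\qquad \mathbb G=\{(\mathbf R\cdot)_\#\nu_0:\mathbf R\in\mathrm{SO}(3)\}.$$ Then $\mathbb F,\mathbb G\subset\mathcal P^+_{\phi,c}(\mathrm{SO}(3))$, and $\mathcal N_{h,\phi}[\mathbb F]$ and $\mathcal N_{h,\phi}[\mathbb G]$ are linearly separable in $L^\infty_\rho(\mathbb R)$.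
   Context: For $\theta\in\mathrm{SO}(3)$ and a finite Borel measure $\mu$ on $\mathrm{SO}(3)$, the restricted Radon transform on $\mathrm{SO}(3)$ is $\mathcal R_{\phi,\theta}[\mu]=(\phi(\cdot,\theta))_\#\mu$. Fix a reference Borel probability measure $\rho$ on $\mathbb R$ without atoms. For a probability measure $\nu$ on $\mathbb R$ with $F_\nu(t)=\nu((-\infty,t])$, let $F_\nu^{[-1]}(t)=\inf\{s:F_\nu(s)>t\}$ and the CDT $\hat\nu=F_\nu^{[-1]}\circ F_\rho$; $\widehat{\mathcal R}_{\phi,\theta}[\mu]$ is the CDT of $\mathcal R_{\phi,\theta}[\mu]$. For $g\in L^2_\rho(\mathbb R)$, $\operatorname{mean}(g)=\int g\,\mathrm d\rho$, $\operatorname{std}(g)=(\int|g-\operatorname{mean}(g)|^2\mathrm d\rho)^{1/2}$; for a probability measure on $\mathbb R$, $\operatorname{std}$ is its standard deviation. $\mathcal P^+_{\phi,c}(\mathrm{SO}(3))$ is the set of Borel probability measures $\mu$ on $\mathrm{SO}(3)$ for which there is $c>0$ with $\operatorname{std}(\mathcal R_{\phi,\theta}[\mu])\ge c$ for all $\theta\in\mathrm{SO}(3)$. For such $\mu$, $\mathcal N_\phi[\mu](t,\theta)=\big(\widehat{\mathcal R}_{\phi,\theta}[\mu](t)-\operatorname{mean}(\widehat{\mathcal R}_{\phi,\theta}[\mu])\big)/\operatorname{std}(\widehat{\mathcal R}_{\phi,\theta}[\mu])$ and $\mathcal N_{h,\phi}[\mu](t)=h(\mathcal N_\phi[\mu](t,\cdot))$.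 Subsets $A,B$ of a normed space $V$ are linearly separable if there exist a continuous linear functional $\ell$ on $V$ and $c\in\mathbb R$ with $\ell>c$ on $A$ and $\ell<c$ on $B$.
   Formalization: The formal theorem additionally assumes that N_{h,φ}[μ0] and N_{h,φ}[ν0] are Borel measurable functions of t, since a bounded invariant h need not yield elements of L^∞_ρ(R); their inequality is read as not ρ-a.e. equal. *)

(* Defs.v *)
From HB Require Import structures.
From mathcomp Require Import all_boot all_order all_algebra.
From mathcomp Require Import all_classical all_reals all_analysis.
Set Implicit Arguments.
Unset Strict Implicit.
Unset Printing Implicit Defensive.
Import Order.TTheory GRing.Theory Num.Theory.
Import numFieldNormedType.Exports.
Local Open Scope classical_set_scope.
Local Open Scope ring_scope.

Definition SO3_pred (R : realType) : pred 'M[R]_3 :=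
  fun M => (M^T *m M == 1%:M) && (\det M == 1).

Definition SO3 (R : realType) := {M : 'M[R]_3 | SO3_pred M}.

Lemma SO3_one (R : realType) : SO3_pred (1%:M : 'M[R]_3).
Proof. by rewrite /SO3_pred trmx1 mul1mx eqxx det1 eqxx. Qed.

HB.instance Definition _ (R : realType) := Choice.on (SO3 R).
HB.instance Definition _ (R : realType) :=
  isPointed.Build (SO3 R) (exist _ 1%:M (SO3_one R)).

Definition SO3_open (R : realType) : set (set (SO3 R)) :=
  [set (@sval _ _) @^-1` U | U in [set U : set 'M[R]_3 | open U]].

Arguments SO3_open R : clear implicits.

Definition SO3m (R : realType) := g_sigma_algebraType (SO3_open R).

Lemma SO3_mul_proof (R : realType) (Q x : SO3 R) :
  SO3_pred (sval Q *m sval x).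
Proof.
case: Q x => [Q /andP[/eqP HQ /eqP dQ]] [x /andP[/eqP Hx /eqP dx]] /=.
apply/andP; split; apply/eqP.
- by rewrite trmx_mul mulmxA -(mulmxA _ _ Q) HQ mulmx1 Hx.
- by rewrite det_mulmx dQ dx mulr1.
Qed.

Definition SO3_lmul (R : realType) (Q : SO3 R) : SO3m R -> SO3m R :=
  fun x => exist _ (sval Q *m sval x) (SO3_mul_proof Q x).

Definition phiSO3 (R : realType) (x theta : SO3m R) : R :=
  acos ((\tr ((sval theta)^T *m sval x) - 1) / 2).

Section radon.
Context {R : realType}.
Local Open Scope ereal_scope.

Definition radon (mu : probability (SO3m R) R) (theta : SO3m R)
  : set R -> \bar R :=
  pushforward mu (fun x => phiSO3 x theta).

Local Close Scope ereal_scope.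

Definition cdf (nu : set R -> \bar R) (t : R) : R := fine (nu [set` `]-oo, t]]).

Definition ginv (F : R -> R) (t : R) : R := inf [set s | t < F s].

Definition cdt (rho : probability R R) (nu : set R -> \bar R) : R -> R :=
  ginv (cdf nu) \o cdf rho.

Definition meanL (rho : probability R R) (g : R -> R) : R :=
  Rintegral rho setT g.
Definition stdL (rho : probability R R) (g : R -> R) : R :=
  Num.sqrt (Rintegral rho setT (fun t => (g t - meanL rho g) ^+ 2)).

(* standard deviation of the law R_{phi,theta}[mu] = (phi(.,theta))_# mu,
   written via the change-of-variables formula for the pushforward *)
Definition std_radon (mu : probability (SO3m R) R) (theta : SO3m R) : R :=
  let f := fun x => phiSO3 x theta in
  Num.sqrt (Rintegral mu setT
     (fun x => (f x - Rintegral mu setT f) ^+ 2)).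

Definition Pplus (c : R) (mu : probability (SO3m R) R) : Prop :=
  forall theta : SO3m R, c <= std_radon mu theta.

Definition Nphi (rho : probability R R) (mu : probability (SO3m R) R)
    (t : R) (theta : SO3m R) : R :=
  let g := cdt rho (radon mu theta) in
  (g t - meanL rho g) / stdL rho g.

Definition Nhphi (h : (SO3m R -> R) -> R) (rho : probability R R)
    (mu : probability (SO3m R) R) : R -> R :=
  fun t => h (Nphi rho mu t).

Lemma one_le_infty : ((1 : \bar R) <= +oo)%E.
Proof. exact: leey. Qed.

Definition Linf (rho : probability R R) := LfunType rho one_le_infty.

Definition Linf_norm (rho : probability R R) (f : Linf rho) : R :=
  fine ('N[rho]_(+oo%E)[EFin \o (f : R -> R)]).

Definition lin_separable_Linf (rho : probability R R) (A B : set (R -> R))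
  : Prop :=
  (forall f, A f -> f \in Lfun rho +oo%E) /\
  (forall f, B f -> f \in Lfun rho +oo%E) /\
  exists (l : Linf rho -> R) (c : R),
    (forall (a : R) (f g : Linf rho), l (a *: f + g) = a * l f + l g) /\
    (forall (f : Linf rho) (e : R), 0 < e -> exists2 d : R, 0 < d &
        forall g : Linf rho, Linf_norm (g - f) < d -> `|l g - l f| < e) /\
    (forall f : Linf rho, A (f : R -> R) -> c < l f) /\
    (forall f : Linf rho, B (f : R -> R) -> l f < c).

End radon.

(* Main.v *)
Require Import Defs.
From HB Require Import structures.
From mathcomp Require Import all_boot all_order all_algebra.
From mathcomp Require Import all_classical all_reals all_analysis.
From mathcomp Require Import measurable_realfun ess_sup_inf.
Import Order.TTheory GRing.Theory Num.Theory.
Import numFieldNormedType.Exports.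
Local Open Scope classical_set_scope.
Local Open Scope ring_scope.

(* Rotating a measure by Q only precomposes theta with the bijection
   theta |-> Q^T theta, so the invariance of h collapses each orbit to a single
   function; two functions of L^oo that differ on a set of positive measure are
   separated by integration against their difference.  The invariance of h only
   applies to bounded functions, and the functions N_phi(t, .) are bounded by
   pi / c because phi takes values in [0, pi] and, rho being atomless, the CDT
   pushes rho forward to the Radon transform, so that both have the same
   standard deviation. *)

(** * Measurability of the arccosine and of the rotation angle *)

Lemma acos_outside {R : realType} (x : R) : ~~ (-1 <= x <= 1) -> acos x = 0.
Proof.
(* No angle has cosine [x], so the choice operator returns its default value 0. *)
move=> xN1; rewrite unlock /acos; case: xgetP => //= y _ [_ cyx].
by move: xN1; rewrite -cyx cos_geN1 cos_le1.
Qed.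

Lemma acos_itv {R : realType} (x : R) : 0 <= acos x <= pi.
Proof.
have [/acos_def[]//|/acos_outside ->] := boolP (-1 <= x <= 1).
by rewrite lexx pi_ge0.
Qed.

(** The arccosine is continuous on the open interval and 0 off [[-1, 1[]: its value at 1 agrees with
    the default value outside. Only the point -1, where it jumps to pi, needs a piece of its own. *)
Lemma measurable_acos {R : realType} : measurable_fun [set: R] (@acos R).
Proof.
have -> : [set: R] = `]-1, 1[%classic `|` ([set -1] `|` ~` `[-1, 1[%classic).
  apply/esym; rewrite -subTset => x _ /=; rewrite !in_itv/=.
  have [->|xN1] := eqVneq x (-1); first by right; left.
  rewrite le_eqVlt eq_sym (negbTE xN1) /=.
  by have [?|?] := boolP (-1 < x < 1); [left|right; right; apply/negP].
have mC : measurable (~` `[-1, 1[%classic : set R) by exact: measurableC.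
apply/measurable_funU => //; first exact: measurableU.
split.
  apply: open_continuous_measurable_fun => [|x]; first exact: interval_open.
  by rewrite inE/= in_itv/= => ?; exact: continuous_acos.
apply/measurable_funU => //; split; first exact: measurable_fun_set1.
have : measurable_fun (~` `[-1, 1[%classic : set R) (cst 0 : R -> R) by [].
apply: eq_measurable_fun => x.
rewrite inE/= in_itv/= => /negP xC.
have [->|x1] := eqVneq x 1; first by rewrite acos1.
by rewrite acos_outside// (le_eqVlt x) (negbTE x1).
Qed.

Lemma mulmx_continuous {R : realType} m n p (A : 'M[R]_(m, n)) :
  continuous (fun M : 'M[R]_(n, p) => A *m M).
Proof.
move=> M B [P /= Pnbhs PB].
have Pnear i j : \forall M' \near M, P i j ((A *m M') i j).
  have c : continuous (fun N : 'M[R]_(n, p) => (A *m N) i j).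
    rewrite (_ : (fun _ => _) =
                 fun N : 'M[R]_(n, p) => \sum_(k < n) A i k * N k j); last first.
      by apply/funext => N; rewrite mxE.
    apply: (@continuous_big R^o 'I_n +%R 0 xpredT add_continuous) => k _ N.
    apply: continuousM; [exact: cst_continuous|exact: coord_continuous].
  exact: (c M _ (Pnbhs i j)).
(* Neighbourhoods of a matrix are entrywise; there are finitely many entries, so the conditions on
   them hold simultaneously near [M]. *)
have Pnear' : \forall M' \near M, forall i j, P i j ((A *m M') i j).
  apply: (@filter_forall _ _ (fun i N => forall j, P i j ((A *m N) i j))
    _ (nbhs_filter M)) => i.
  exact: (@filter_forall _ _ (fun j N => P i j ((A *m N) i j))
    _ (nbhs_filter M) (Pnear i)).
by apply: filterS Pnear' => N ?; exact: PB.
Qed.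

Lemma mxtrace_continuous {R : realType} n :
  continuous (fun M : 'M[R]_n => \tr M).
Proof. 
apply: (@continuous_big R^o 'I_n +%R 0 xpredT add_continuous) => k _.
exact: coord_continuous.
Qed.

Lemma measurable_phiSO3 {R : realType} (theta : SO3m R) :
  measurable_fun [set: SO3m R] (fun x => phiSO3 x theta).
Proof.
have mtr : measurable_fun [set: SO3m R]
    (fun x : SO3m R => \tr ((sval theta)^T *m sval x)).
  apply: (measurability _ (RGenOpens.measurableE R)).
  move=> _ [_ [a [b ->]] <-]; rewrite setTI; apply: sub_sigma_algebra.
  (* The trace formula is continuous on all matrices, so the preimage of an open interval is cut out
     on SO(3) by an open set of matrices, hence is a generator. *)
  exists ((fun M : 'M[R]_3 => \tr ((sval theta)^T *m M)) @^-1`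
    `]a, b[%classic) => //.
  apply: open_comp; last exact: interval_open.
  move=> M _; apply: continuous_comp; first exact: mulmx_continuous.
  exact: mxtrace_continuous.
apply: measurableT_comp; first exact: measurable_acos.
by apply: measurable_funM => //; exact: measurable_funB.
Qed.

(** * Left multiplication on SO(3) *)

Lemma measurable_SO3_lmul {R : realType} (Q : SO3m R) :
  measurable_fun [set: SO3m R] (SO3_lmul Q).
Proof.
apply: (@measurability _ _ _ (SO3m R) _ _ (SO3_open R) erefl)
  => _ [_ [U oU <-] <-].
rewrite setTI; apply: sub_sigma_algebra.
exists ((fun M : 'M[R]_3 => sval Q *m M) @^-1` U) => //.
by apply: open_comp => // M _; exact: mulmx_continuous.
Qed.

Lemma SO3_tr_proof {R : realType} (Q : SO3 R) : SO3_pred (sval Q)^T.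
Proof.
case: Q => Q /= /andP[/eqP QtQ /eqP detQ].
by rewrite /SO3_pred trmxK det_tr detQ (mulmx1C QtQ) !eqxx.
Qed.

Definition SO3_tr {R : realType} (Q : SO3m R) : SO3m R :=
  exist _ (sval Q)^T (SO3_tr_proof Q).

Lemma SO3_lmulK {R : realType} (Q : SO3m R) :
  cancel (SO3_lmul Q) (SO3_lmul (SO3_tr Q)).
Proof.
move=> x; apply/val_inj => /=; case: Q => Q /= /andP[/eqP QtQ _].
by rewrite mulmxA QtQ mul1mx.
Qed.

Lemma SO3_trK {R : realType} : involutive (@SO3_tr R).
Proof. by move=> Q; apply/val_inj; rewrite /= trmxK. Qed.

Lemma SO3_lmul_tr_bij {R : realType} (Q : SO3m R) :
  bijective (SO3_lmul (SO3_tr Q)).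
Proof.
exists (SO3_lmul Q); last exact: SO3_lmulK.
by move=> x; rewrite -{1}(SO3_trK Q) SO3_lmulK.
Qed.

(** Transposition reverses products, which moves a rotation of the point onto the parameter. *)
Lemma phiSO3_lmul {R : realType} (Q x theta : SO3m R) :
  phiSO3 (SO3_lmul Q x) theta = phiSO3 x (SO3_lmul (SO3_tr Q) theta).
Proof. by rewrite /phiSO3/= trmx_mul trmxK mulmxA. Qed.

Lemma probability_setU_null {d} {T : measurableType d} {R : realType}
    {P : probability T R} {A B : set T} :
  measurable A -> measurable B -> P B = 0%E -> P (A `|` B) = P A.
Proof. by move=> mA mB PB; exact: measureU0. Qed.

(** * Distribution functions on the real line *)

Section cdf_of_probability.
Context {R : realType} (nu : probability R R).
Local Notation F := (Defs.cdf nu).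

(** Under [nu], the identity is a random variable with law [nu]; results on [cdf] of random
    variables thus transfer to measures. *)
Let idR : R -> R := idfun.
#[local] HB.instance Definition _ :=
  @isMeasurableFun.Build _ _ _ _ idR (@measurable_id _ _ setT).

Lemma EFin_cdf (r : R) : (F r)%:E = nu `]-oo, r]%classic.
Proof. by rewrite /Defs.cdf fineK// fin_num_measure. Qed.

Let EFin_cdfE (r : R) : (F r)%:E = cdf (idR : {RV nu >-> R}) r.
Proof. exact: EFin_cdf. Qed.

Let cdfE : F = fine \o cdf (idR : {RV nu >-> R}).
Proof. by []. Qed.

Lemma fcdf_ge0 (r : R) : 0 <= F r.
Proof. by rewrite -lee_fin EFin_cdf. Qed.

Lemma fcdf_le1 (r : R) : F r <= 1.
Proof. by rewrite -lee_fin EFin_cdf probability_le1. Qed.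

Lemma cdf_homo : nondecreasing_fun F.
Proof. by move=> r s rs; rewrite -lee_fin !EFin_cdfE cdf_nondecreasing. Qed.

Lemma measurable_cdf : measurable_fun setT F.
Proof. by apply: nondecreasing_measurable => //; exact: cdf_homo. Qed.

Lemma measurable_cdf_preimage (A : set R) : measurable A ->
  measurable (F @^-1` A).
Proof.
by move=> mA; rewrite -[X in measurable X]setTI; exact: measurable_cdf.
Qed.

Lemma measurable_cdf_le (u : R) : measurable [set t | F t <= u].
Proof.
rewrite (_ : [set _ | _] = F @^-1` `]-oo, u]%classic).
  exact: measurable_cdf_preimage.
by apply/seteqP; split=> t /=; rewrite in_itv.
Qed.

Lemma measurable_cdf_lt (u : R) : measurable [set t | F t < u].
Proof.
rewrite (_ : [set _ | _] = F @^-1` `]-oo, u[%classic).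
  exact: measurable_cdf_preimage.
by apply/seteqP; split=> t /=; rewrite in_itv.
Qed.

Lemma cdf_gt_ex (u : R) : u < 1 -> exists s, u < F s.
Proof.
move=> u1; have F1 : F @ +oo --> (1 : R).
  by rewrite cdfE; apply: fine_cvg; exact: cvg_cdfy1.
exact: filter_ex (cvgr_gt _ F1 _ u1).
Qed.

Lemma cdf_lt_ex (u : R) : 0 < u -> exists s, F s < u.
Proof.
move=> u0; have F0 : F @ -oo --> (0 : R).
  by rewrite cdfE; apply: fine_cvg; exact: cvg_cdfNy0.
exact: filter_ex (cvgr_lt _ F0 _ u0).
Qed.

(** By right-continuity, [F s < u] would persist slightly to the right of [s]. *)
Lemma cdf_le_right (u s : R) : (forall s', s < s' -> u <= F s') -> u <= F s.
Proof.
move=> us; rewrite leNgt; apply/negP => Fsu.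
have Fs : F x @[x --> s^'+] --> F s.
  rewrite cdfE; apply: fine_cvg; rewrite fineK ?fin_num_measure//.
  exact: cdf_right_continuous.
have : \forall x \near s^'+, s < x /\ F x < u.
  by apply: filterI; [exact: nbhs_right_gt|exact: cvgr_lt Fs _ Fsu].
move=> /filter_ex[x [sx]]; apply/negP; rewrite -leNgt; exact: us.
Qed.

(** Without an atom at [a], [F a] is the mass of the open half-line, which is the limit of
    [F (a - 1/(n+1))] by continuity from below. *)
Lemma cdf_le_left (u a : R) : nu [set a] = 0%E ->
  (forall t, t < a -> F t <= u) -> F a <= u.
Proof.
move=> a0 au.
have aE : `]-oo, a[%classic = \bigcup_n `]-oo, a - n.+1%:R^-1]%classic :> set R.
  apply/seteqP; split => [t|t [n _]] /=; rewrite !in_itv/=.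
    move=> ta; have [k tka] := ltr_add_invr ta.
    by exists k => //=; rewrite in_itv/= lerBrDr ltW.
  by move=> /le_lt_trans; apply; rewrite ltrBlDr ltrDl.
have cvg_nu : nu `]-oo, a - n.+1%:R^-1]%classic @[n --> \oo] -->
    nu (\bigcup_n `]-oo, a - n.+1%:R^-1]%classic).
  apply: nondecreasing_cvg_mu => //; first exact: bigcup_measurable.
  move=> n m nm; apply/subsetPset; apply: subset_itvl.
  by rewrite bnd_simp lerD2l lerN2 lef_pV2 ?posrE// ler_nat.
have lea : (nu `]-oo, a[%classic <= u%:E)%E.
  rewrite aE; apply: (cvge_to_le cvg_nu); apply: nearW => n /=.
  by rewrite -EFin_cdf lee_fin au// ltrBlDr ltrDl.
by rewrite -lee_fin EFin_cdf -(@setUitv1 _ _ _ _ true)// probability_setU_null.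
Qed.

End cdf_of_probability.

(** * The probability integral transform: [F] is uniform under an atomless law *)

Section probability_integral_transform.
Context {R : realType} (rho : probability R R).
Hypothesis rho_atomless : forall x : R, rho [set x] = 0%E.
Local Notation F := (Defs.cdf rho).
Let mle := measurable_cdf_le rho.
Let mlt := measurable_cdf_lt rho.

(** The sublevel set is the half-line up to its supremum [a], and [F a = u]: absence of atoms gives
    one inequality, right-continuity the other. *)
Lemma atomless_cdf_le (u : R) : 0 <= u <= 1 -> rho [set t | F t <= u] = u%:E.
Proof.
move=> /andP[u0]; rewrite le_eqVlt => /predU1P[->|u1].
  rewrite (_ : [set _ | _] = setT) ?probability_setT//.
  by rewrite -subTset => t _ /=; exact: fcdf_le1.
(* Since [F] tends to 0 at minus infinity, the sublevel set can be empty only for [u = 0]. *)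
have [A0|/set0P An0] := eqVneq [set t | F t <= u] set0.
  rewrite A0 measure0; congr EFin; apply/le_anti/andP; split => //.
  rewrite leNgt; apply/negP => /(cdf_lt_ex rho)[s /ltW su].
  by have : [set t | F t <= u] s by []; rewrite A0.
have [s us] := cdf_gt_ex rho _ u1.
have ubA : ubound [set t | F t <= u] s.
  move=> t /= Ftu; rewrite leNgt; apply/negP => /ltW/(cdf_homo rho).
  by apply/negP; rewrite -ltNge (le_lt_trans Ftu).
set a := sup [set t | F t <= u].
have Fa : F a = u.
  apply/le_anti/andP; split.
    apply: cdf_le_left => // t /(sup_gt An0)[y /= Fyu /ltW ty].
    by rewrite (le_trans _ Fyu)//; exact: cdf_homo.
  apply: cdf_le_right => t at_; rewrite leNgt; apply/negP => /ltW Ftu.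
  have : t <= a by apply: ub_le_sup => //; exists s.
  by apply/negP; rewrite -ltNge.
rewrite -Fa EFin_cdf; congr (rho _); apply/seteqP; split => t /=.
  rewrite in_itv/= Fa => Ftu; apply: ub_le_sup => //; by exists s.
by rewrite in_itv/=; exact: cdf_homo.
Qed.

Lemma atomless_cdf_lt (u : R) : 0 <= u <= 1 -> rho [set t | F t < u] = u%:E.
Proof.
move=> /andP[u0 u1]; apply/le_anti/andP; split.
  rewrite -atomless_cdf_le ?u0// le_measure ?inE//.
  by move=> t /= /ltW.
rewrite -(fineK (fin_num_measure rho _ (mlt u))) lee_fin.
rewrite leNgt; apply/negP => ltu.
(* If the mass were below [u], the set where [F t <= v] would have mass [v] and yet lie in a set of
   smaller mass. *)
have [v /andP[v1 v2]] : exists v : R, fine (rho [set t | F t < u]) < v < u.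
  by exists ((fine (rho [set t | F t < u]) + u) / 2); rewrite !midf_lt.
have v0 : 0 <= v by rewrite (le_trans _ (ltW v1))// fine_ge0.
move: v1; apply/negP; rewrite -leNgt -lee_fin fineK ?fin_num_measure//.
rewrite -atomless_cdf_le ?v0 ?(le_trans (ltW v2))//.
by rewrite le_measure ?inE// => t /= /le_lt_trans; apply.
Qed.

End probability_integral_transform.

(** Half-lines determine the mass of []a, b]] by subtraction, and these intervals form a generating
    family stable under intersection and exhausting the line. *)
Lemma cdf_probability_unique {R : realType} (P Q : probability R R) :
  (forall s : R, P `]-oo, s]%classic = Q `]-oo, s]%classic) ->
  forall A : set R, measurable A -> P A = Q A.
Proof.
move=> PQ A mA.
apply: (@measure_unique _ _ R (@ocitv R)
  (fun n => `]-n%:R, n%:R]%classic)) => //.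
- exact: ocitvI.
- by move=> n; exact: is_ocitv.
- rewrite -subTset => x _; exists (Num.Def.archi_bound `|x|) => //=.
  have xb : `|x| < (Num.Def.archi_bound `|x|)%:R by rewrite archi_boundP.
  by rewrite in_itv/=; move: xb; rewrite ltr_norml => /andP[-> /ltW].
- move=> _ [[a b] _ <-] /=.
  have [ab|ba] := leP a b; last first.
    by rewrite set_itv_ge ?measure0// bnd_simp -leNgt ltW.
  have -> : `]a, b]%classic = `]-oo, b] `\` `]-oo, a] :> set R.
    by rewrite -[RHS]setCK setCD setCitvl setUC -[LHS]setCK setCitv.
  rewrite !measureD//= ?(le_lt_trans (probability_le1 _ _)) ?ltry//.
  rewrite !setIidr; try exact: subset_itvl.
  by rewrite !PQ.
- by move=> n; rewrite (le_lt_trans (probability_le1 _ _)) ?ltry.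
Qed.

(** * The generalized inverse of a distribution function *)

Section ginv_cdf.
Context {R : realType} (nu : probability R R).
Local Notation F := (Defs.cdf nu).
Local Notation G := (ginv F).

Let ginv_nonempty (u : R) : u < 1 -> [set s | u < F s] !=set0.
Proof. by move=> /(cdf_gt_ex nu)[s us]; exists s. Qed.

Let ginv_lbound (u : R) : 0 < u -> has_lbound [set s | u < F s].
Proof.
move=> /(cdf_lt_ex nu)[s su]; exists s => t /= ut.
rewrite leNgt; apply/negP => /ltW/(cdf_homo nu).
by apply/negP; rewrite -ltNge (lt_trans su).
Qed.

Lemma ginv_cdf_le (u s : R) : 0 < u -> u < F s -> G u <= s.
Proof. by move=> u0 us; apply: ge_inf => //; exact: ginv_lbound. Qed.

(** With [ginv_cdf_le] this is a Galois connection up to strictness. The infimum need not be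
    attained, so the bound is first obtained to the right of [s]. The condition [u < 1] makes the
    defining set nonempty. *)
Lemma le_cdf_ginv (u s : R) : u < 1 -> G u <= s -> u <= F s.
Proof.
move=> u1 Gus; apply: cdf_le_right => s' ss'.
have [|r /= ur rs'] := @inf_lt _ [set s | u < F s] s' (ginv_nonempty _ u1).
  exact: le_lt_trans ss'.
by rewrite (le_trans (ltW ur))//; apply: cdf_homo; exact: ltW.
Qed.

Lemma ginv_cdf_homo (u v : R) : 0 < u -> v < 1 -> u <= v -> G u <= G v.
Proof.
move=> u0 v1 uv; apply: lb_le_inf; first exact: ginv_nonempty.
by move=> s /= vs; apply: ginv_cdf_le => //; exact: le_lt_trans vs.
Qed.

(* For [1 <= u] the set defining [ginv] is empty and [inf] returns the junk
   value 0, which still lies in the interval. *)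
Lemma ginv_cdf_itv (b u : R) : 0 <= b -> 0 <= u ->
  (forall s, s < 0 -> F s = 0) -> F b = 1 -> 0 <= G u <= b.
Proof.
move=> b0 u0 F0 Fb; rewrite /ginv.
have lb0 : lbound [set s | u < F s] 0.
  move=> s /= us; rewrite leNgt; apply/negP => /F0 Fs.
  by move: us; rewrite Fs ltNge u0.
have [->|/set0P Sn0] := eqVneq [set s | u < F s] set0.
  by rewrite inf0 lexx.
apply/andP; split; first exact: lb_le_inf.
apply: ge_inf; first by exists 0.
by case: Sn0 => s /= us; rewrite Fb (lt_le_trans us)// fcdf_le1.
Qed.

End ginv_cdf.

(** * The CDT transports the reference measure *)

Section cdt_pushforward.
Context {R : realType} (rho : probability R R).
Hypothesis rho_atomless : forall x : R, rho [set x] = 0%E.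
Variable nu : probability R R.
Local Notation Fr := (Defs.cdf rho).
Local Notation F := (Defs.cdf nu).

(** Where [Fr] lies strictly between 0 and 1 the CDT is monotone, so preimages of half-lines are
    intervals. Where [Fr] is 0 or 1 it is constant, whatever value [inf] takes there. *)
Lemma measurable_cdt : measurable_fun setT (cdt rho nu).
Proof.
have mFr := measurable_cdf_preimage rho.
rewrite (_ : [set: R] = Fr @^-1` `]0, 1[%classic `|`
    (Fr @^-1` [set 0] `|` Fr @^-1` [set 1])); last first.
  apply/esym; rewrite -subTset => t _ /=; rewrite in_itv/=.
  have := fcdf_ge0 rho t; rewrite le_eqVlt => /predU1P[<-|->].
    by right; left.
  have := fcdf_le1 rho t; rewrite le_eqVlt => /predU1P[->|->].
    by right; right.
  by left.
apply/measurable_funU; [exact: mFr|by apply: measurableU; exact: mFr|split].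
  move=> mD; apply: (measurability (@RGenCInfty.G R)) => //.
    exact: RGenCInfty.measurableE.
  move=> _ [_ [r ->] <-]; apply: is_interval_measurable => s t/=.
  rewrite !in_itv/= !andbT => -[/andP[s0 s1] rs] [/andP[t0 t1] rt] u.
  move=> /andP[su ut].
  have {}su := cdf_homo rho _ _ su; have {}ut := cdf_homo rho _ _ ut.
  rewrite !in_itv/= andbT (lt_le_trans s0)// (le_lt_trans ut)//; split => //.
  apply: (le_trans rs); apply: ginv_cdf_homo => //; exact: le_lt_trans t1.
have mcst u : measurable_fun (Fr @^-1` [set u]) (cdt rho nu).
  have : measurable_fun (Fr @^-1` [set u]) (cst (ginv F u) : R -> R) by [].
  by apply: eq_measurable_fun => t; rewrite inE/= /cdt/= => ->.
by apply/measurable_funU; [exact: mFr|exact: mFr|split].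
Qed.

(** Up to the null sets where [Fr] is 0 or 1, the preimage lies between the sets [Fr t < F s] and
    [Fr t <= F s], both of mass [F s]. *)
Lemma cdt_cdf (s : R) :
  rho (cdt rho nu @^-1` `]-oo, s]%classic) = nu `]-oo, s]%classic.
Proof.
have F01 : 0 <= F s <= 1 by rewrite fcdf_ge0 fcdf_le1.
have mcdt : measurable (cdt rho nu @^-1` `]-oo, s]%classic).
  by rewrite -[X in measurable X]setTI; exact: measurable_cdt.
have mlt := measurable_cdf_lt rho; have mle := measurable_cdf_le rho.
have null0 : rho [set t | Fr t <= 0] = 0%E.
  by rewrite atomless_cdf_le ?lexx ?ler01.
have null1 : rho (~` [set t | Fr t < 1]) = 0%E.
  by rewrite probability_setC// atomless_cdf_lt ?lexx ?ler01// subee.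
rewrite -EFin_cdf; apply/le_anti/andP; split.
  have sub : cdt rho nu @^-1` `]-oo, s]%classic `<=`
      [set t | Fr t <= F s] `|` ~` [set t | Fr t < 1].
    move=> t; rewrite /= in_itv/= => ts.
    have [Ft1|] := boolP (Fr t < 1); last by right; apply/negP.
    by left; exact: le_cdf_ginv ts.
  have mC := measurableC (mlt 1).
  rewrite -(atomless_cdf_le _ rho_atomless _ F01).
  rewrite -(probability_setU_null (mle _) mC null1).
  by apply: le_measure; rewrite ?inE//; exact: measurableU.
have sub : [set t | Fr t < F s] `<=`
    cdt rho nu @^-1` `]-oo, s]%classic `|` [set t | Fr t <= 0].
  move=> t /= ts; rewrite in_itv/=.
  by have [|Ft0] := leP (Fr t) 0; [right|left; exact: ginv_cdf_le].
rewrite -(atomless_cdf_lt _ rho_atomless _ F01).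
rewrite -(probability_setU_null mcdt (mle 0) null0).
by apply: le_measure; rewrite ?inE//; exact: measurableU.
Qed.

Let mcdt_mixin := @isMeasurableFun.Build _ _ _ _ (cdt rho nu) measurable_cdt.
Let mcdt : {mfun R >-> R} := HB.pack (cdt rho nu) mcdt_mixin.

Lemma cdt_pushforward (A : set R) : measurable A ->
  rho (cdt rho nu @^-1` A) = nu A.
Proof.
by move=> mA; apply: (cdf_probability_unique (distribution rho mcdt)) => // s; exact: cdt_cdf.
Qed.

End cdt_pushforward.

(** * Integral functionals on the space of essentially bounded functions *)

Section Linf_separation.
Context {R : realType} (rho : probability R R).

Lemma Linf_norm_ge (u : Linf rho) : \forall x \ae rho, `|u x| <= Linf_norm u.
Proof.
have uN : 'N[rho]_+oo%E[EFin \o u]%E = (Linf_norm u)%:E.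
  by rewrite /Linf_norm finite_norm_fine.
have : (ess_sup rho (abse \o (EFin \o u)) <= (Linf_norm u)%:E)%E.
  (* The norm is the essential supremum only when the total mass is positive; here it is 1. *)
  by rewrite -uN unlock /= probability_setT lte01.
by move=> /ess_supP; apply: filterS => x /=; rewrite lee_fin.
Qed.

Let rho_fin : rho setT \is a fin_num. Proof. exact: fin_num_measure. Qed.

Lemma Linf_integrable (u : Linf rho) : rho.-integrable setT (EFin \o u).
Proof.
apply/Lfun1_integrable.
apply: (@Lfun_subset _ _ _ rho 1%E +oo%E (lexx _) one_le_infty rho_fin
  one_le_infty).
exact: LfunP.
Qed.

Lemma Linf_mul_integrable (u v : Linf rho) :
  rho.-integrable setT (EFin \o (fun x => u x * v x)).
Proof.
have l2 (z : Linf rho) : (z : R -> R) \in Lfun rho 2%:E.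
  apply: (@Lfun_subset _ _ _ rho 2%:E +oo%E (lee1n _) one_le_infty rho_fin
    (leey _)).
  exact: LfunP.
exact/Lfun1_integrable/(Lfun2_mul_Lfun1 (l2 u) (l2 v)).
Qed.

Definition Linf_pair (w u : Linf rho) : R :=
  Rintegral rho setT (fun x => u x * w x).

Lemma Linf_pair_linear (w : Linf rho) (a : R) (u v : Linf rho) :
  Linf_pair w (a *: u + v) = a * Linf_pair w u + Linf_pair w v.
Proof.
have iu := Linf_mul_integrable u w; have iv := Linf_mul_integrable v w.
rewrite /Linf_pair -RintegralZl// -RintegralD//; last exact: integrableZl iu.
by apply: eq_Rintegral => x _; rewrite mulrA -mulrDl.
Qed.

(** Hölder's inequality for the exponents infinity and 1: the almost everywhere bound on [u] is
    integrated against the modulus of [w]. *)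
Lemma Linf_pair_le (w u : Linf rho) :
  `|Linf_pair w u| <= Linf_norm u * \int[rho]_x `|w x|.
Proof.
have iuw := Linf_mul_integrable u w.
apply: (le_trans (le_normr_Rintegral measurableT iuw)).
have iw : rho.-integrable setT (EFin \o (fun x => `|w x|)).
  exact: integrable_norm (Linf_integrable w).
have iNw : rho.-integrable setT (EFin \o (fun x => Linf_norm u * `|w x|)).
  exact: integrableZl iw.
have iauw := integrable_norm iuw.
rewrite -RintegralZl// /Rintegral fine_le ?integrable_fin_num//.
apply: ae_ge0_le_integral => //.
- exact: measurable_int iauw.
- by move=> x _; rewrite lee_fin mulr_ge0// fine_ge0// Lnorm_ge0.
- exact: measurable_int iNw.
- apply: filterS (Linf_norm_ge u) => x ux _.
  by rewrite lee_fin normrM ler_wpM2r.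
Qed.

Lemma Linf_pair_continuous (w u : Linf rho) (e : R) : 0 < e ->
  exists2 d : R, 0 < d &
    forall v : Linf rho, Linf_norm (v - u) < d ->
      `|Linf_pair w v - Linf_pair w u| < e.
Proof.
move=> e0; set I := \int[rho]_x `|w x|.
have I0 : 0 <= I by apply: Rintegral_ge0.
(* The added 1 keeps the denominator positive when [w] vanishes almost everywhere. *)
exists (e / (I + 1)); first by rewrite divr_gt0// ltr_wpDl.
move=> v uv.
have -> : Linf_pair w v - Linf_pair w u = Linf_pair w (v - u).
  rewrite addrC -mulN1r -Linf_pair_linear; congr (Linf_pair w _).
  by rewrite scaleN1r addrC.
apply: (le_lt_trans (Linf_pair_le w (v - u))).
have : Linf_norm (v - u) * (I + 1) < e by rewrite -ltr_pdivlMr// ltr_wpDl.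
apply: le_lt_trans; rewrite ler_wpM2l ?lerDl// fine_ge0// Lnorm_ge0//.
Qed.

(* Pairing against [f - g] separates [f] from [g], since the difference of
   the two values is the integral of [(f - g) ^+ 2]. *)
Lemma Linf_pair_sub_lt (f g : Linf rho) : ~ ((f : R -> R) = g %[ae rho]) ->
  Linf_pair (f - g) g < Linf_pair (f - g) f.
Proof.
move=> fg; rewrite -subr_gt0.
have -> : Linf_pair (f - g) f - Linf_pair (f - g) g =
    Linf_pair (f - g) (f - g).
  rewrite addrC -mulN1r -Linf_pair_linear; congr (Linf_pair _ _).
  by rewrite scaleN1r addrC.
have iw := Linf_mul_integrable (f - g) (f - g).
have sq x : 0 <= (f - g) x * (f - g) x by rewrite -expr2 sqr_ge0.
rewrite lt_def Rintegral_ge0 ?andbT//.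
apply/eqP => Iw; apply: fg.
have : (\int[rho]_x `|((f - g) x * (f - g) x)%:E| = 0)%E.
  transitivity (\int[rho]_x ((f - g) x * (f - g) x)%:E)%E.
    by apply: eq_integral => x _; rewrite gee0_abs// lee_fin.
  by rewrite -[LHS]fineK ?integrable_fin_num//; congr EFin.
move=> /(ae_eq_integral_abs _ measurableT (measurable_int _ iw)).
apply: filterS => x /(_ I) [] /eqP.
by rewrite mulf_eq0 orbb => fgx _; apply/eqP; rewrite -subr_eq0.
Qed.

End Linf_separation.

(** * Integrals of bounded functions and change of variables *)

Section bounded_integrals.
Context {R : realType}.

Lemma probability_bounded_integrable {d} {T : measurableType d}
    (P : probability T R) (f : T -> R) (M : R) :
  measurable_fun setT f -> (forall x, `|f x| <= M) ->
  P.-integrable setT (EFin \o f).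
Proof.
move=> mf fM; apply: measurable_bounded_integrable => //.
  by rewrite ltey_eq fin_num_measure.
exists M; split; first exact: num_real.
by move=> N MN x _ /=; rewrite (le_trans (fM x)) ?ltW.
Qed.

Lemma Rintegral_itv {d} {T : measurableType d} (P : probability T R)
    (f : T -> R) (b : R) :
  measurable_fun setT f -> (forall x, 0 <= f x <= b) ->
  0 <= Rintegral P setT f <= b.
Proof.
move=> mf f0b; have f0 x : 0 <= f x by case/andP: (f0b x).
rewrite Rintegral_ge0//=.
have intf : P.-integrable setT (EFin \o f).
  apply: (probability_bounded_integrable _ _ b) => // x.
  by rewrite ger0_norm//; case/andP: (f0b x).
have := @le_Rintegral _ _ _ P setT f (cst b) measurableT intf.
have PT : P setT = 1%E by exact: probability_setT.
rewrite Rintegral_cst// [X in fine X]PT mulr1; apply.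
  exact: finite_measure_integrable_cst.
by move=> x _; case/andP: (f0b x).
Qed.

(** The bound concerns [f \o k] only, so that [f] may be the identity or a square, unbounded on the
    line but bounded on the range of [k]. *)
Lemma Rintegral_pushforward_bounded {d1 d2} {S : measurableType d1}
    {T : measurableType d2} (P : probability S R) (Q : probability T R)
    (k : S -> T) (f : T -> R) (M : R) :
  measurable_fun setT k -> measurable_fun setT f ->
  (forall A, measurable A -> P (k @^-1` A) = Q A) ->
  (forall x, `|f (k x)| <= M) ->
  Rintegral Q setT f = Rintegral P setT (f \o k).
Proof.
move=> mk mf PQ fkM; rewrite /Rintegral; congr fine.
pose K : {mfun S >-> T} := HB.pack k (@isMeasurableFun.Build _ _ _ _ k mk).
rewrite (@eq_measure_integral _ _ _ _ (distribution P K)).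
  rewrite integral_distribution//; first exact/measurable_EFinP.
  apply: (probability_bounded_integrable _ (f \o k) M) => //.
  exact: measurableT_comp.
by move=> A mA _; exact/esym/PQ.
Qed.

End bounded_integrals.

(** * Mean and standard deviation of the CDT of a bounded variable *)

Section cdt_of_bounded_variable.
Context {R : realType} (rho : probability R R).
Hypothesis rho_atomless : forall x : R, rho [set x] = 0%E.
Context {d} {T : measurableType d} (P : probability T R) (X : T -> R).
Hypothesis mX : measurable_fun setT X.
Variable b : R.
Hypotheses (b0 : 0 <= b) (X0b : forall x, 0 <= X x <= b).

Let XX : {mfun T >-> R} := HB.pack X (@isMeasurableFun.Build _ _ _ _ X mX).
(** This is [pushforward P X] packaged as a probability, to which the results on the CDT apply. *)
Let nu : probability R R := distribution P XX.
Local Notation g := (cdt rho (pushforward P X)).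

(** The law of [X] is carried by [[0, b]], so its distribution function is 0 on the negatives and 1
    at [b]. The bound holds at every [t], not just almost everywhere. *)
Lemma cdt_itv (t : R) : 0 <= g t <= b.
Proof.
apply: (ginv_cdf_itv nu b _ b0 (fcdf_ge0 rho t)) => [s s0|].
  apply/EFin_inj; rewrite EFin_cdf; transitivity (P set0); last exact: measure0.
  congr (P _).
  apply/seteqP; split => x //=; rewrite in_itv/= leNgt (lt_le_trans s0)//.
  by case/andP: (X0b x).
apply/EFin_inj; rewrite EFin_cdf; transitivity (P setT);
  last exact: probability_setT.
congr (P _); apply/seteqP; split => x //= _; rewrite in_itv/=.
by case/andP: (X0b x).
Qed.

Let mg : measurable_fun setT g.
Proof. exact: (measurable_cdt rho nu). Qed.

(** Both sides equal the integral of [f] against [nu], pulled back once along [g] and once along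
    [X]. *)
Lemma Rintegral_cdt (f : R -> R) (M : R) : measurable_fun setT f ->
  (forall x, 0 <= x <= b -> `|f x| <= M) ->
  Rintegral rho setT (f \o g) = Rintegral P setT (f \o X).
Proof.
move=> mf fM.
rewrite -(@Rintegral_pushforward_bounded _ _ _ _ _ P nu X f M)//; last first.
  by move=> x; exact: fM.
rewrite -(@Rintegral_pushforward_bounded _ _ _ _ _ rho nu g f M)//; last first.
  by move=> x; apply: fM; exact: cdt_itv.
by move=> A mA; exact: cdt_pushforward.
Qed.

Lemma meanL_cdt : meanL rho g = Rintegral P setT X.
Proof.
apply: (@Rintegral_cdt idfun b); first exact: measurable_id.
move=> x /andP[x0 xb].
by rewrite ger0_norm.
Qed.

Lemma meanL_cdt_itv : 0 <= meanL rho g <= b.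
Proof. by rewrite meanL_cdt; exact: Rintegral_itv. Qed.

Lemma cdt_dist_mean (x : R) : 0 <= x <= b -> `|x - meanL rho g| <= b.
Proof.
have /andP[m0 mb] := meanL_cdt_itv; move=> /andP[x0 xb].
rewrite ler_norml lerBrDr lerBlDr (le_trans _ x0) ?(le_trans xb) ?lerDl//.
by rewrite addrC subr_le0.
Qed.

Lemma stdL_cdt : stdL rho g =
  Num.sqrt (Rintegral P setT (fun x => (X x - Rintegral P setT X) ^+ 2)).
Proof.
rewrite /stdL -meanL_cdt; congr Num.sqrt.
apply: (@Rintegral_cdt (fun x => (x - meanL rho g) ^+ 2) (b ^+ 2)).
  by apply: measurable_funX; exact: measurable_funB.
by move=> x xb; rewrite normrX lerXn2r ?nnegrE// cdt_dist_mean.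
Qed.

End cdt_of_bounded_variable.

(** * The normalized transform: bounds and behaviour under rotation *)

Lemma phiSO3_itv {R : realType} (x theta : SO3m R) : 0 <= phiSO3 x theta <= pi.
Proof. exact: acos_itv. Qed.

Lemma stdL_radon {R : realType} (rho : probability R R)
    (mu : probability (SO3m R) R) (theta : SO3m R) :
  (forall x : R, rho [set x] = 0%E) ->
  stdL rho (cdt rho (radon mu theta)) = std_radon mu theta.
Proof.
move=> rho0.
exact: (stdL_cdt rho rho0 mu _ (measurable_phiSO3 theta) pi (pi_ge0 R)
  (phiSO3_itv ^~ theta)).
Qed.

(** A CDT value and the mean both lie in [[0, pi]], and the denominator is at least [c]. The bound
    is pointwise, as the assumptions on [h] require. *)
Lemma Nphi_bounded {R : realType} (rho : probability R R) (c : R)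
    (mu : probability (SO3m R) R) (t : R) (theta : SO3m R) :
  (forall x : R, rho [set x] = 0%E) -> 0 < c -> Pplus c mu ->
  `|Nphi rho mu t theta| <= pi / c.
Proof.
move=> rho0 c0 /(_ theta) c_std.
rewrite /Nphi stdL_radon// normrM normfV.
have -> : `|std_radon mu theta| = std_radon mu theta.
  by rewrite ger0_norm// (le_trans (ltW c0)).
apply: ler_pM => //; first by rewrite invr_ge0 (le_trans (ltW c0)).
  apply: (cdt_dist_mean rho rho0 mu _ (measurable_phiSO3 theta) pi (pi_ge0 R)
    (phiSO3_itv ^~ theta)).
  exact: (cdt_itv rho mu _ (measurable_phiSO3 theta) pi (pi_ge0 R)
    (phiSO3_itv ^~ theta)).
by rewrite lef_pV2 ?posrE// (lt_le_trans c0).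
Qed.

Section rotation.
Context {R : realType} (mu0 mu : probability (SO3m R) R) (Q : SO3m R).
Hypothesis muE : (mu : set (SO3m R) -> \bar R) = pushforward mu0 (SO3_lmul Q).

Lemma radon_rotation (theta : SO3m R) :
  radon mu theta = radon mu0 (SO3_lmul (SO3_tr Q) theta).
Proof.
rewrite /radon muE /pushforward; apply/funext => A; congr (mu0 _).
by apply/seteqP; split => x /=; rewrite phiSO3_lmul.
Qed.

Lemma Nphi_rotation (rho : probability R R) (t : R) :
  Nphi rho mu t = Nphi rho mu0 t \o SO3_lmul (SO3_tr Q).
Proof. by apply/funext => theta; rewrite /Nphi/= radon_rotation. Qed.

(** [std_radon] integrates against the measure on SO(3), whereas [stdL] of the CDT sees that measure
    only through [radon]; passing through the latter makes [radon_rotation] applicable. *)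
Lemma Pplus_rotation (rho : probability R R) (c : R) :
  (forall x : R, rho [set x] = 0%E) -> Pplus c mu0 -> Pplus c mu.
Proof.
move=> rho0 mu0P theta.
by rewrite -(stdL_radon rho)// radon_rotation stdL_radon.
Qed.

End rotation.

Lemma Linf_of_bounded {R : realType} (rho : probability R R) (f : R -> R)
    (K : R) :
  measurable_fun setT f -> (forall x, `|f x| <= K) -> f \in Lfun rho +oo%E.
Proof.
move=> mf fK; apply/andP; split; rewrite inE//=.
rewrite /finite_norm unlock; case: ifPn => // _.
apply: (@le_lt_trans _ _ K%:E); last exact: ltry.
by apply/ess_supP; apply: nearW => x /=; rewrite lee_fin.
Qed.

Theorem theorem20 (R : realType)
  (rho : probability R R)
  (rho_atomless : forall x : R, rho [set x] = 0%E)
  (h : (SO3m R -> R) -> R)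
  (h_bounded : forall M : R, exists K : R, forall g : SO3m R -> R,
      (forall x, `|g x| <= M) -> `|h g| <= K)
  (h_inv : forall (g : SO3m R -> R) (psi : SO3m R -> SO3m R),
      (exists M : R, forall x, `|g x| <= M) ->
      bijective psi -> h (g \o psi) = h g)
  (c : R) (c_gt0 : 0 < c)
  (mu0 nu0 : probability (SO3m R) R)
  (mu0P : Pplus c mu0) (nu0P : Pplus c nu0)
  (mu0_meas : measurable_fun setT (Nhphi h rho mu0))
  (nu0_meas : measurable_fun setT (Nhphi h rho nu0))
  (neq : ~ (Nhphi h rho mu0 = Nhphi h rho nu0 %[ae rho])) :
  let FF := [set mu : probability (SO3m R) R | exists Q : SO3m R,
              (mu : set (SO3m R) -> \bar R) = pushforward mu0 (SO3_lmul Q)] in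
  let GG := [set mu : probability (SO3m R) R | exists Q : SO3m R,
              (mu : set (SO3m R) -> \bar R) = pushforward nu0 (SO3_lmul Q)] in
  FF `<=` Pplus c /\ GG `<=` Pplus c /\
  lin_separable_Linf rho (Nhphi h rho @` FF) (Nhphi h rho @` GG).
Proof.
move=> FF GG.
have Nhphi_rotation (mu1 mu : probability (SO3m R) R) (Q : SO3m R) :
    Pplus c mu1 ->
    (mu : set (SO3m R) -> \bar R) = pushforward mu1 (SO3_lmul Q) ->
    Nhphi h rho mu = Nhphi h rho mu1.
  move=> mu1P muE; apply/funext => t; rewrite /Nhphi (Nphi_rotation _ _ _ muE).
  apply: h_inv; last exact: SO3_lmul_tr_bij.
  by exists (pi / c) => theta; exact: Nphi_bounded.
have Nhphi_Linf (mu1 : probability (SO3m R) R) : Pplus c mu1 ->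
    measurable_fun setT (Nhphi h rho mu1) -> Nhphi h rho mu1 \in Lfun rho +oo%E.
  move=> mu1P mmu1; have [K hK] := h_bounded (pi / c).
  apply: (Linf_of_bounded _ _ K) => // t.
  by apply: hK => theta; exact: Nphi_bounded.
(* Each image has at most one element, so separating two functions suffices. *)
have imF f : (Nhphi h rho @` FF) f -> f = Nhphi h rho mu0.
  by move=> [mu [Q muE] <-]; exact: Nhphi_rotation muE.
have imG f : (Nhphi h rho @` GG) f -> f = Nhphi h rho nu0.
  by move=> [mu [Q muE] <-]; exact: Nhphi_rotation muE.
split; first by move=> mu [Q muE]; exact: Pplus_rotation muE rho _ rho_atomless mu0P.
split; first by move=> mu [Q muE]; exact: Pplus_rotation muE rho _ rho_atomless nu0P.
split; first by move=> f /imF ->; exact: Nhphi_Linf.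
split; first by move=> f /imG ->; exact: Nhphi_Linf.
pose f0 : Linf rho := Lfun_Sub one_le_infty (Nhphi_Linf _ mu0P mu0_meas).
pose g0 : Linf rho := Lfun_Sub one_le_infty (Nhphi_Linf _ nu0P nu0_meas).
have lt_fg : Linf_pair rho (f0 - g0) g0 < Linf_pair rho (f0 - g0) f0.
  exact: Linf_pair_sub_lt.
exists (Linf_pair rho (f0 - g0)).
(* The threshold is the midpoint of the two values of the functional. *)
exists ((Linf_pair rho (f0 - g0) g0 + Linf_pair rho (f0 - g0) f0) / 2).
split; first exact: Linf_pair_linear.
split; first by move=> f e0; exact: Linf_pair_continuous.
split => [f /imF ff0|f /imG fg0].
  have -> : f = f0 by apply/LfuneqP => x; rewrite ff0.
  by rewrite (midf_lt lt_fg).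
have -> : f = g0 by apply/LfuneqP => x; rewrite fg0.
by rewrite (midf_lt lt_fg).
Qed.
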